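(* Let $\mathcal K$ be a complete idempotent semifield. Let $C$ be a complete convex subset of a complete right $\mathcal K$-semimodule $X$, and let $x\in X$ with $x\notin C$. Put $$\nu=\bigvee_{v\in C}\big((v\backslash x)\wedge e\big)\in\mathcal K,\qquad y=\bigvee_{v\in C}v\big((v\backslash x)\wedge e\big)\in X .$$ Then $$(v\backslash x)\wedge e=(v\backslash y)\wedge\nu\quad\text{for all }v\in C,$$ and $$(x\backslash x)\wedge e>(x\backslash y)\wedge\nu .$$
   Context: A semiring $(\mathcal K,\oplus,\otimes,\varepsilon,e)$ (neutral elements $\varepsilon$ for $\oplus$ and $e$ for $\otimes$, with $\varepsilon$ absorbing for $\otimes$) is idempotent if $a\oplus a=a$ for all $a$. An idempotent commutative monoid carries the natural order $a\le b\iff a\oplus b=b$. An ordered set is complete if every subset $U$ has a least upper bound $\bigvee U$ (it is then a complete lattice; $\wedge$ denotes greatest lower bound). A map $f$ between complete ordered sets is continuous if $f(\bigvee U)=\bigvee f(U)$ for every subset $U$ (including $U=\varnothing$). An idempotent semiring is complete if it is complete for its natural order and all its left and right multiplications are continuous. A complete idempotent semifield is a complete idempotent semiring $\mathcal K$ (not necessarily commutative) in which all elements except $\varepsilon$ and the top element $\top\mathcal K$ have a multiplicative inverse. A right $\mathcal K$-semimodule is a commutative monoid $(X,\oplus,\varepsilon)$ with a right action $(x,\lambda)\mapsto x\lambda$ satisfying $x(\lambda\mu)=(x\lambda)\mu$, $(x\oplus y)\lambda=x\lambda\oplus y\lambda$, $x(\lambda\oplus\mu)=x\lambda\oplus x\mu$,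 $x\varepsilon=\varepsilon$, $xe=x$; its addition is then idempotent. It is complete if it is complete for its natural order and the maps $X\to X$, $x\mapsto x\lambda$ ($\lambda\in\mathcal K$) and $\mathcal K\to X$, $\mu\mapsto v\mu$ ($v\in X$) are all continuous. For $x,y\in X$: $x\backslash y=\max\{\lambda\in\mathcal K\mid x\lambda\le y\}$. A subset $C\subset X$ is complete convex if for all arbitrary families $\{x_i\}_{i\in I}\subset C$ and $\{\alpha_i\}_{i\in I}\subset\mathcal K$ with $\bigvee_{i\in I}\alpha_i=e$, one has $\bigvee_{i\in I}x_i\alpha_i\in C$. The notation $a>b$ means $a\ge b$ and $a\ne b$. *)

(* Defs.v *)
From HB Require Import structures.
From mathcomp Require Import all_boot all_order all_algebra.
From mathcomp Require Import boolp classical_sets.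

Set Implicit Arguments.
Unset Strict Implicit.
Unset Printing Implicit Defensive.

Import Order.TTheory GRing.Theory.
Local Open Scope classical_set_scope.
Local Open Scope ring_scope.

(* Throughout, the semiring notations (oplus, otimes, epsilon, e) become      *)
(* (+, *, 0, 1).                                                              *)

HB.mixin Record hasIdempotentAdd V of GRing.Nmodule V := {
  addrr_idem : forall a : V, a + a = a
}.

#[short(type="idemNmodType")]
HB.structure Definition IdemNmodule :=
  { V of GRing.Nmodule V & hasIdempotentAdd V }.

(* An alias of V that carries the natural order, so that V does not have to   *)
(* come with an order of its own.                                             *)
Definition natural (V : Type) : Type := V.

Section NaturalOrder.
Variable V : idemNmodType.
Implicit Types a b c : V.

Definition natural_le a b := a + b == b.

Fact natural_le_refl : reflexive natural_le.
Proof. by move=> a; rewrite /natural_le addrr_idem. Qed.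

Fact natural_le_anti : antisymmetric natural_le.
Proof. by move=> a b /andP[/eqP ab /eqP ba]; rewrite -ba addrC. Qed.

Fact natural_le_trans : transitive natural_le.
Proof.
move=> b a c /eqP ab /eqP bc; apply/eqP.
by rewrite -bc addrA ab.
Qed.

Fact natural_display : Order.disp_t. Proof. exact: Order.Disp tt tt. Qed.

HB.instance Definition _ := Choice.copy (natural V) V.
HB.instance Definition _ := Order.Le_isPOrder.Build natural_display (natural V)
  natural_le_refl natural_le_anti natural_le_trans.

End NaturalOrder.

Notation "a <=n b" := ((a : natural _) <= (b : natural _))%O
  (at level 70, no associativity) : ring_scope.
Notation "a <n b" := ((a : natural _) < (b : natural _))%O
  (at level 70, no associativity) : ring_scope.
Notation "a >n b" := (b <n a)
  (at level 70, no associativity, only parsing) : ring_scope.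

HB.mixin Record hasSupremums V of IdemNmodule V := {
  supremums_neq0 : forall U : set (natural V), supremums U !=set0
}.

#[short(type="completeNmodType")]
HB.structure Definition CompleteNmodule :=
  { V of IdemNmodule V & hasSupremums V }.

Section CompleteOrder.
Variable V : completeNmodType.
Implicit Types (a b : V) (U : set V).

(* The default value 0 is the least element, hence also the correct value at  *)
(* the empty set (see [bigveeP]).                                             *)
Definition bigvee U : V := supremum (0 : natural V) (U : set (natural V)).

Definition wedge a b : V := infimum (0 : natural V) [set (a : natural V); b].

Definition top : V := bigvee setT.

Lemma natural_ge0 a : 0 <=n a.
Proof. by apply/eqP; rewrite add0r. Qed.

Lemma bigveeP U : supremums (U : set (natural V)) (bigvee U).
Proof.
rewrite /bigvee /supremum; case: eqP => [->|_].
  by split=> [b []|b _]; apply: natural_ge0.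
by have [s sU] := supremums_neq0 (U : set (natural V)); apply: (xgetI _ sU).
Qed.

Lemma wedgeP a b : infimums [set (a : natural V); b] (wedge a b).
Proof.
have ab0 : [set (a : natural V); b] == set0 = false.
  by apply/negbTE/set0P; exists a; left.
rewrite /wedge /infimum ab0.
have [s [s1 s2]] := supremums_neq0 (lbound [set (a : natural V); b]).
have si : infimums [set (a : natural V); b] s.
  by split=> // c abc; apply: s2 => d dl; apply: dl.
exact: (xgetI _ si).
Qed.

End CompleteOrder.

Definition sup_continuous (V W : completeNmodType) (f : V -> W) :=
  forall U : set V, f (bigvee U) = bigvee (f @` U).

HB.mixin Record hasContinuousMul K
    of GRing.PzSemiRing K & CompleteNmodule K := {
  sup_continuous_mull : forall a : K, sup_continuous (fun b : K => a * b);
  sup_continuous_mulr : forall a : K, sup_continuous (fun b : K => b * a)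
}.

#[short(type="completeIdemSemiringType")]
HB.structure Definition CompleteIdemSemiring :=
  { K of GRing.PzSemiRing K & CompleteNmodule K & hasContinuousMul K }.

HB.mixin Record hasInverses K of CompleteIdemSemiring K := {
  has_inverse : forall a : K, a <> 0 -> a <> top K ->
    exists b : K, a * b = 1 /\ b * a = 1
}.

#[short(type="completeIdemSemifieldType")]
HB.structure Definition CompleteIdemSemifield :=
  { K of CompleteIdemSemiring K & hasInverses K }.

(* A right K-semimodule is a left semimodule over the converse semiring K^c:  *)
(* [scalerA] then reads x *:> (l * m) = (x *:> l) *:> m, with l * m in K.     *)
Definition ract (K : pzSemiRingType) (X : lSemiModType K^c) (x : X) (l : K) :
  X := (l : K^c) *: x.

Notation "x *:> l" := (ract x l) (at level 40, left associativity) : ring_scope.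

HB.mixin Record hasContinuousAction (K : completeIdemSemiringType) X
    of GRing.LSemiModule K^c X & CompleteNmodule X := {
  sup_continuous_ractl : forall l : K, sup_continuous (fun x : X => x *:> l);
  sup_continuous_ractr : forall v : X, sup_continuous (fun m : K => v *:> m)
}.

#[short(type="completeRSemiModType")]
HB.structure Definition CompleteRSemiModule (K : completeIdemSemiringType) :=
  { X of GRing.LSemiModule K^c X & CompleteNmodule X
       & hasContinuousAction K X }.

Section Residuation.
Variables (K : completeIdemSemiringType) (X : completeRSemiModType K).
Implicit Types (x y : X) (C : set X).

Definition is_max (A : set (natural K)) (m : natural K) := A m /\ ubound A m.

(* The maximum exists by continuity (see [residualP]), so the default value   *)
(* is never used.                                                             *)
Definition residual x y : K := xget 0 (is_max [set l | x *:> l <=n y]).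

Lemma residualP x y : is_max [set l | x *:> l <=n y] (residual x y).
Proof.
have mx : is_max [set l | x *:> l <=n y] (bigvee [set l | x *:> l <=n y]).
  have [ub _] := bigveeP [set l : K | x *:> l <=n y]; split=> //=.
  rewrite (sup_continuous_ractr x).
  have [_ lub] := bigveeP [set x *:> l | l in [set l : K | x *:> l <=n y]].
  by apply: lub => _ [l /= ? <-].
exact: (xgetI _ mx).
Qed.

Definition complete_convex C :=
  forall (I : Type) (x : I -> X) (alpha : I -> K),
    (forall i, C (x i)) -> bigvee (range alpha) = 1 ->
    C (bigvee (range (fun i => x i *:> alpha i))).

End Residuation.

(* Main.v *)
(* The element y lies below x and nu below e, so the maps v |-> (v\x) /\ e and
   v |-> (v\y) /\ nu agree on C. At x they can only agree if nu = e and x = y;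
   but then y is a convex combination of C, so x would belong to C. *)
Require Import Defs.
From mathcomp Require Import all_boot all_order all_algebra.
From mathcomp Require Import boolp classical_sets.

Set Implicit Arguments.
Unset Strict Implicit.
Unset Printing Implicit Defensive.

Import Order.TTheory GRing.Theory.
Local Open Scope classical_set_scope.
Local Open Scope ring_scope.

Section CompleteOrder.
Variable V : completeNmodType.
Implicit Types (a b c : V) (U : set V).

Lemma bigvee_ub U a : U a -> a <=n bigvee U.
Proof. by have [ub _] := bigveeP U; exact: ub. Qed.

Lemma bigvee_lub U a : (forall b, U b -> b <=n a) -> bigvee U <=n a.
Proof. by have [_ lub] := bigveeP U; move=> Ua; apply: lub => b; exact: Ua. Qed.

Lemma wedge_lel a b : wedge a b <=n a.
Proof. by have [lb _] := wedgeP a b; apply: lb; left. Qed.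

Lemma wedge_ler a b : wedge a b <=n b.
Proof. by have [lb _] := wedgeP a b; apply: lb; right. Qed.

Lemma le_wedge a b c : c <=n a -> c <=n b -> c <=n wedge a b.
Proof.
by have [_ glb] := wedgeP a b; move=> ca cb; apply: glb => d [|] ->.
Qed.

Lemma wedge_mono a b a' b' :
  a <=n a' -> b <=n b' -> wedge a b <=n wedge a' b'.
Proof.
move=> aa' bb'; apply: le_wedge.
  exact: le_trans (wedge_lel a b) aa'.
exact: le_trans (wedge_ler a b) bb'.
Qed.

End CompleteOrder.

Section Residuation.
Variables (K : completeIdemSemiringType) (X : completeRSemiModType K).
Implicit Types (v x y : X) (l m : K) (C : set X).

Lemma ract1 x : x *:> (1 : K) = x.
Proof. exact: scale1r. Qed.

Lemma ract_le x l m : l <=n m -> x *:> l <=n x *:> m.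
Proof.
move=> /eqP lm; apply/eqP; rewrite /ract -scalerDl.
(* The goal is an equation in [K^c] and [lm] one in [K]: the converse semiring reverses products
   only, so the two additions are convertible. *)
by congr (_ *: _); exact: lm.
Qed.

(** Galois connection between the action on [x] and [residual x]: the set whose maximum is
    [residual x y] is closed downwards because [ract_le] makes the action monotone in the scalar. *)
Lemma le_residual x y l : (l <=n residual x y) = (x *:> l <=n y).
Proof.
have [rle rmax] := residualP x y; apply/idP/idP => [lr|].
  exact: le_trans (ract_le x lr) rle.
exact: rmax.
Qed.

Lemma residual_le v x y : x <=n y -> residual v x <=n residual v y.
Proof.
by move=> xy; rewrite le_residual; apply: le_trans xy; rewrite -le_residual.
Qed.

(** Convexity speaks of families indexed by a type, so [C] is indexed by itself through the subtype
    [{v | C v}]. *)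
Lemma complete_convex_image C (f : X -> K) :
  complete_convex C -> bigvee [set f v | v in C] = 1 ->
  C (bigvee [set v *:> f v | v in C]).
Proof.
have imageE (T : Type) (g : X -> T) :
    [set g v | v in C] = range (fun v : {v | C v} => g (sval v)).
  apply/seteqP; split=> [_ [v Cv <-]|_ [[v Cv] _ <-]]; last by exists v.
  by exists (exist _ v Cv).
rewrite !imageE => hC f1.
by apply: (hC _ (fun v : {v | C v} => sval v)) f1 => -[].
Qed.

End Residuation.

Theorem corollary15 (K : completeIdemSemifieldType)
    (X : completeRSemiModType K) (C : set X) (x : X)
    (hC : complete_convex C) (hx : ~ C x) :
  let nu : K := bigvee [set wedge (residual v x) 1 | v in C] in
  let y : X := bigvee [set v *:> wedge (residual v x) 1 | v in C] in
  (forall v : X, C v -> wedge (residual v x) 1 = wedge (residual v y) nu) /\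
  wedge (residual x x) 1 >n wedge (residual x y) nu.
Proof.
move=> nu y.
have yx : y <=n x.
  by apply: bigvee_lub => _ [v _ <-]; rewrite -le_residual wedge_lel.
have nu1 : nu <=n 1 by apply: bigvee_lub => _ [v _ <-]; exact: wedge_ler.
split=> [v Cv|].
  apply/(@le_anti _ (natural K))/andP; split.
    (* For [v] in [C], the scalar on the left is one of the terms joined in [nu], and [v] times it
       is one of those joined in [y]; residuation turns the latter bound into one by
       [residual v y]. *)
    apply: le_wedge; last by apply: bigvee_ub; exists v.
    by rewrite le_residual; apply: bigvee_ub; exists v.
  exact: wedge_mono (residual_le v yx) nu1.
have xx1 : (1 : K) <=n wedge (residual x x) 1.
  by apply: le_wedge; rewrite ?le_residual ?ract1.
rewrite lt_neqAle wedge_mono ?residual_le // andbT.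
apply/negP => /eqP eq_wedge; apply: hx.
(* Under the supposed equality, [xx1] puts 1 below both [nu] and [residual x y]. *)
have nuE : nu = 1.
  apply/(@le_anti _ (natural K)); rewrite nu1 /=.
  by apply: le_trans xx1 _; rewrite -eq_wedge wedge_ler.
suff -> : x = y by exact: complete_convex_image.
(* By residuation, 1 below [residual x y] means that [x *:> 1], which is [x], lies below [y]. *)
apply/(@le_anti _ (natural X)); rewrite yx andbT -[X in X <=n _](@ract1 K).
by rewrite -le_residual; apply: le_trans xx1 _; rewrite -eq_wedge wedge_lel.
Qed.
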